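(* Let $\mathcal{A}$ be a finite group and $m$ a positive integer. Then the number $\mathcal{E}^w(\mathcal{A},m)$ of weak equivalence classes of Cayley graphs $C(\mathcal{A},\Omega)$ of degree $m$ satisfies $$\mathcal{E}^w(\mathcal{A},m)=\sum_{k=0}^{\lfloor m/2\rfloor}|G_{m,k}(\mathcal{A})/\mathrm{Aut}(\mathcal{A})|=\sum_{k=0}^{\lfloor m/2\rfloor}\frac{\sum_{(\alpha,\sigma,\tau)\in\mathrm{Aut}(\mathcal{A})\times\mathcal{K}_k}|F_{(\alpha,\sigma,\tau)}(m,k,\mathcal{A})|}{|\mathrm{Aut}(\mathcal{A})|\,k!\,(m-2k)!},$$ and the number $\mathcal{E}(\mathcal{A},m)$ of equivalence classes of Cayley graphs $C(\mathcal{A},\Omega)$ of degree $m$ satisfies $$\mathcal{E}(\mathcal{A},m)=\sum_{k=0}^{\lfloor m/2\rfloor}|G_{m,k}(\mathcal{A})/\mathrm{Inn}(\mathcal{A})|=\sum_{k=0}^{\lfloor m/2\rfloor}\frac{\sum_{(\alpha,\sigma,\tau)\in\mathrm{Inn}(\mathcal{A})\times\mathcal{K}_k}|F_{(\alpha,\sigma,\tau)}(m,k,\mathcal{A})|}{|\mathrm{Inn}(\mathcal{A})|\,k!\,(m-2k)!}.$$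
   Context: Let $\mathcal{A}$ be a finite group with identity $e$. For $\Omega\subseteq\mathcal{A}$ generating $\mathcal{A}$ with $\Omega=\Omega^{-1}$, $e\notin\Omega$, the Cayley graph $C(\mathcal{A},\Omega)$ has vertex set $\mathcal{A}$ and edges $\{g,h\}$ with $g^{-1}h\in\Omega$; it has degree $|\Omega|$. $\mathcal{A}$ acts by left multiplication. A graph isomorphism $f:C(\mathcal{A},\Omega)\to C(\mathcal{A},\Omega')$ is a weak equivalence if there is $\alpha\in\mathrm{Aut}(\mathcal{A})$ with $f(gu)=\alpha(g)f(u)$ for all $g,u$, and an equivalence if this holds with $\alpha=\mathrm{id}$. $\mathrm{Aut}(\mathcal{A})$ and $\mathrm{Inn}(\mathcal{A})$ denote the automorphism and inner automorphism groups. Let $G_m(\mathcal{A})=\{\Omega\subseteq\mathcal{A}:\Omega^{-1}=\Omega,\ \langle\Omega\rangle=\mathcal{A},\ |\Omega|=m,\ e\notin\Omega\}$. For $S\subseteq\mathcal{A}$ let $O_2(S)=\{g\in S: g^2=e, g\neq e\}$, and let $G_{m,k}(\mathcal{A})=\{\Omega\in G_m(\mathcal{A}): |O_2(\Omega)|=m-2k\}$. A subgroup $H\le\mathrm{Aut}(\mathcal{A})$ acts on $G_{m,k}(\mathcal{A})$ by $\alpha\cdot\Omega=\alpha(\Omega)$, and $G_{m,k}(\mathcal{A})/H$ denotes the orbit set. For $x\in\mathcal{A}$ let $\overline{x}=\{x,x^{-1}\}$. Let $\bar G_{m,k}(\mathcal{A})$ be the set of all $(m-k)$-tuples $(\overline{x_1},\dots,\overline{x_k},\overline{y_1},\dots,\overline{y_{m-2k}})$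 of pairwise distinct terms such that $x_i^2\neq e$ for all $i$, $y_j^{-1}=y_j\neq e$ for all $j$, and $\{x_1,\dots,x_k,y_1,\dots,y_{m-2k}\}$ generates $\mathcal{A}$. Let $S_k$ be the symmetric group on $k$ letters and $\mathcal{K}_k=S_k\times S_{m-2k}$. The group $\mathrm{Aut}(\mathcal{A})\times\mathcal{K}_k$ acts on $\bar G_{m,k}(\mathcal{A})$ by $(\alpha,\sigma,\tau)\cdot(\overline{x_1},\dots,\overline{x_k},\overline{y_1},\dots,\overline{y_{m-2k}})=(\overline{\alpha(x_{\sigma^{-1}(1)})},\dots,\overline{\alpha(x_{\sigma^{-1}(k)})},\overline{\alpha(y_{\tau^{-1}(1)})},\dots,\overline{\alpha(y_{\tau^{-1}(m-2k)})})$. For $(\alpha,\sigma,\tau)\in\mathrm{Aut}(\mathcal{A})\times\mathcal{K}_k$, $F_{(\alpha,\sigma,\tau)}(m,k,\mathcal{A})$ is the set of elements of $\bar G_{m,k}(\mathcal{A})$ fixed by $(\alpha,\sigma,\tau)$. *)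

(* Defs.v *)
From HB Require Import structures.
From mathcomp Require Import all_boot all_order all_algebra all_fingroup.

Set Implicit Arguments.
Unset Strict Implicit.
Unset Printing Implicit Defensive.

Import GroupScope.

Section CayleyGraphs.

Variable gT : finGroupType.
Implicit Types (O S : {set gT}) (a f : {perm gT}) (m k : nat).

(* For O = O^-1 with 1 \notin O this is a symmetric irreflexive adjacency
   relation on gT: see cayley_sym and cayley_irr. *)
Definition cayley O : rel gT := fun g h => g^-1 * h \in O.

Definition graph_iso f O O' : bool :=
  [forall u, forall v, cayley O u v == cayley O' (f u) (f v)].

Definition weak_equiv O O' : bool :=
  [exists f : {perm gT}, graph_iso f O O' &&
     [exists a in Aut [set: gT], forall g, forall u, f (g * u) == a g * f u]].

Definition equiv O O' : bool :=
  [exists f : {perm gT}, graph_iso f O O' &&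
     [forall g, forall u, f (g * u) == g * f u]].

Definition Inn : {set {perm gT}} := conj_aut [set: gT] @* [set: gT].

Definition Gm m : {set {set gT}} :=
  [set O : {set gT} | [&& O^-1 == O, <<O>> == [set: gT], #|O| == m & 1 \notin O]].

Definition O2 S : {set gT} := [set g in S | (g ^+ 2 == 1) && (g != 1)].

(* Only used for k <= m %/ 2, where the subtraction is exact. *)
Definition Gmk m k : {set {set gT}} :=
  [set O in Gm m | #|O2 O| == (m - 2 * k)%N].

(* C(gT, O) determines O, so classes of graphs of degree m are counted as
   classes of connection sets in Gm m: see weak_equiv_equivalence and
   equiv_equivalence for the side condition of equivalence_partition. *)
Definition num_weak_equiv m : nat := #|equivalence_partition weak_equiv (Gm m)|.
Definition num_equiv m : nat := #|equivalence_partition equiv (Gm m)|.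

(* 'P^* is the action of permutations on sets, O |-> a @: O. *)
Definition Gmk_orbits m k (H : {set {perm gT}}) : {set {set {set gT}}} :=
  orbit 'P^* H @: Gmk m k.

Definition bar (x : gT) : {set gT} := [set x; x^-1].

(* An (m - k)-tuple is split into its first k and its last m - 2k terms. *)
Definition bar_tuple m k : finType :=
  (k.-tuple {set gT} * (m - 2 * k).-tuple {set gT})%type.

Definition barG m k : {set bar_tuple m k} :=
  [set (map_tuple bar z.1, map_tuple bar z.2)
     | z : k.-tuple gT * (m - 2 * k).-tuple gT
     & [&& uniq (map bar z.1 ++ map bar z.2),
           all (fun x => x ^+ 2 != 1) z.1,
           all (fun y => (y^-1 == y) && (y != 1)) z.2
         & <<[set x in z.1 ++ z.2]>> == [set: gT]]].

Definition AutK m k : finType := ({perm gT} * ('S_k * 'S_(m - 2 * k)))%type.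

(* The bar of a x is written as the image a @: bar x: see imset_bar. *)
Definition bar_act m k (p : AutK m k) (t : bar_tuple m k) : bar_tuple m k :=
  let: (a, (s, r)) := p in
  ([tuple a @: tnth t.1 (s^-1 i) | i < k],
   [tuple a @: tnth t.2 (r^-1 j) | j < (m - 2 * k)%N]).

Definition Fix_barG m k (p : AutK m k) : {set bar_tuple m k} :=
  [set t in barG m k | bar_act p t == t].

Definition HK m k (H : {set {perm gT}}) : {set AutK m k} :=
  setX H [set: 'S_k * 'S_(m - 2 * k)].

Lemma cayley_sym O : O^-1 = O -> symmetric (cayley O).
Proof.
by move=> OV g h; rewrite /cayley -{1}OV inE invMg invgK.
Qed.

Lemma cayley_irr O : 1 \notin O -> irreflexive (cayley O).
Proof. by move=> O1 g; rewrite /cayley mulVg (negPf O1). Qed.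

Lemma cayley_inj O O' : cayley O =2 cayley O' -> O = O'.
Proof.
by move=> eqO; apply/setP=> x; move: (eqO 1 x); rewrite /cayley invg1 mul1g.
Qed.

Lemma cayley_degree O g : #|[set h | cayley O g h]| = #|O|.
Proof.
rewrite -[RHS](card_imset _ (mulgI g)); apply: eq_card => h; rewrite inE /cayley.
apply/idP/imsetP => [Oh | [x Ox ->]]; last by rewrite mulKg.
by exists (g^-1 * h) => //; rewrite mulKVg.
Qed.

Lemma weak_equivP O O' :
  reflect (exists f : {perm gT}, exists2 a, a \in Aut [set: gT] &
             (forall u v, cayley O u v = cayley O' (f u) (f v)) /\
             (forall g u, f (g * u) = a g * f u))
          (weak_equiv O O').
Proof.
apply: (iffP existsP) => [[f /andP[/forallP fi /existsP[a /andP[Aa /forallP fa]]]]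
                         | [f [a Aa [fi fa]]]].
  exists f, a => //; split=> [u v | g u]; apply/eqP.
  - by move: v; apply/forallP/fi.
  - by move: u; apply/forallP/fa.
exists f; apply/andP; split; first by apply/'forall_forallP => u v; rewrite fi.
by apply/existsP; exists a; rewrite Aa; apply/'forall_forallP => g u; rewrite fa.
Qed.

Lemma equivP O O' :
  reflect (exists f : {perm gT},
             (forall u v, cayley O u v = cayley O' (f u) (f v)) /\
             (forall g u, f (g * u) = g * f u))
          (equiv O O').
Proof.
apply: (iffP existsP) => [[f /andP[/forallP fi /forallP fa]] | [f [fi fa]]].
  exists f; split=> [u v | g u]; apply/eqP.
  - by move: v; apply/forallP/fi.
  - by move: u; apply/forallP/fa.
exists f; apply/andP; split; first by apply/'forall_forallP => u v; rewrite fi.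
by apply/'forall_forallP => g u; rewrite fa.
Qed.

Lemma weak_equiv_refl : reflexive weak_equiv.
Proof.
move=> O; apply/weak_equivP; exists 1, 1; first exact: group1.
by split=> *; rewrite !perm1.
Qed.

Lemma weak_equiv_sym : symmetric weak_equiv.
Proof.
suff sym O O' : weak_equiv O O' -> weak_equiv O' O.
  by move=> O O'; apply/idP/idP; apply: sym.
case/weak_equivP=> f [a Aa [fi fa]]; apply/weak_equivP.
exists f^-1, a^-1; first by rewrite groupV.
split=> [u v | g u]; first by rewrite fi !permKV.
by apply: (@perm_inj _ f); rewrite fa !permKV.
Qed.

Lemma weak_equiv_trans : transitive weak_equiv.
Proof.
move=> O2' O1 O3 /weak_equivP[f [a Aa [fi fa]]] /weak_equivP[g [b Ab [gi ga]]].
apply/weak_equivP; exists (f * g), (a * b); first exact: groupM.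
by split=> *; rewrite !permM ?fi ?gi ?fa ?ga.
Qed.

Lemma weak_equiv_equivalence : equivalence_rel weak_equiv.
Proof.
apply/equivalence_relP; split; first exact: weak_equiv_refl.
exact: (sym_left_transitive weak_equiv_sym weak_equiv_trans).
Qed.

Lemma equiv_refl : reflexive equiv.
Proof. by move=> O; apply/equivP; exists 1; split=> *; rewrite !perm1. Qed.

Lemma equiv_sym : symmetric equiv.
Proof.
suff sym O O' : equiv O O' -> equiv O' O.
  by move=> O O'; apply/idP/idP; apply: sym.
case/equivP=> f [fi fa]; apply/equivP; exists f^-1.
split=> [u v | g u]; first by rewrite fi !permKV.
by apply: (@perm_inj _ f); rewrite fa !permKV.
Qed.

Lemma equiv_trans : transitive equiv.
Proof.
move=> O2' O1 O3 /equivP[f [fi fa]] /equivP[g [gi ga]].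
apply/equivP; exists (f * g).
by split=> *; rewrite !permM ?fi ?gi ?fa ?ga.
Qed.

Lemma equiv_equivalence : equivalence_rel equiv.
Proof.
apply/equivalence_relP; split; first exact: equiv_refl.
exact: (sym_left_transitive equiv_sym equiv_trans).
Qed.

Lemma imset_bar a x : a \in Aut [set: gT] -> a @: bar x = bar (a x).
Proof.
move=> Aa; rewrite /bar imsetU1 imset_set1; congr [set _; _].
by rewrite -!(autmE Aa) morphV ?inE.
Qed.

Lemma InnP a :
  reflect (exists c, forall x, a x = x ^ c) (a \in Inn).
Proof.
apply: (iffP imsetP) => [[c _ ->] | [c ac]].
  by exists c => x; rewrite norm_conj_autE ?inE //; apply/subsetP=> ?; rewrite inE.
exists c; first by rewrite !inE andbT; apply/subsetP=> ?; rewrite inE.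
apply/permP=> x; rewrite ac norm_conj_autE ?inE //.
by apply/subsetP=> ?; rewrite inE.
Qed.

End CayleyGraphs.

(* Main.v *)
Require Import Defs.
From mathcomp Require Import all_boot all_order all_algebra all_fingroup.
From mathcomp Require Import zify.

(* A graph isomorphism f with f (g u) = a(g) f(u) is u |-> a(u) c with c = f 1,
   and it carries C(A, O) to C(A, O') exactly when O' = a(O)^c.  So the weak
   equivalence (resp. equivalence) classes of connection sets are the orbits of
   Aut A (resp. Inn A) on G_m, and G_m is the disjoint union of the invariant
   pieces G_{m,k}, because the elements of O that are not involutions come in
   pairs {x, x^-1}.  Sending a tuple of bars to the union of its terms maps the
   tuples onto G_{m,k}; its fibres are the orbits of S_k x S_{m-2k} and it is
   Aut A-equivariant, so H-orbits on G_{m,k} correspond to orbits of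
   H x S_k x S_{m-2k} on tuples, which the Cauchy-Frobenius lemma counts. *)

Set Implicit Arguments.
Unset Strict Implicit.
Unset Printing Implicit Defensive.

Import GroupScope.

(** * Comparing sizes of images and of orbit sets *)

Lemma card_imset_eq_kernel (aT rT rT' : finType) (f : aT -> rT) (g : aT -> rT')
    (D : {set aT}) :
    {in D &, forall x y, (f x == f y) = (g x == g y)} ->
  #|f @: D| = #|g @: D|.
Proof.
move=> fg; have [->|[x0 Dx0]] := set_0Vmem D; first by rewrite !imset0 !cards0.
(* [h] chooses a point of [D] in each fibre of [f]; the default [x0] is never reached on [f @: D].
   Then [g \o h] maps [f @: D] bijectively onto [g @: D]. *)
pose h y := odflt x0 [pick x in D | f x == y].
have hP x : x \in D -> h (f x) \in D /\ f (h (f x)) = f x.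
  move=> Dx; rewrite /h; case: pickP => [y /andP[Dy /eqP] //| /(_ x)].
  by rewrite Dx eqxx.
have -> : g @: D = (g \o h) @: (f @: D).
  rewrite -imset_comp; apply: eq_in_imset => x Dx /=.
  by have [Dh fh] := hP x Dx; apply/eqP; rewrite -fg // fh.
rewrite [RHS]card_in_imset // => _ _ /imsetP[x Dx ->] /imsetP[y Dy ->] /= /eqP.
have [Dhx fhx] := hP x Dx; have [Dhy fhy] := hP y Dy.
by rewrite -fg // fhx fhy => /eqP.
Qed.

(** On [S], the orbit map and the orbit map after [f] identify the same pairs of points. *)
Lemma card_orbits_equivariant (aT aT' : finGroupType) (rT rT' : finType)
    (to : {action aT &-> rT}) (to' : {action aT' &-> rT'})
    (G : {group aT}) (G' : {group aT'}) (S : {set rT}) (f : rT -> rT') :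
    {in S &, forall x y,
      (x \in orbit to G y) = (f x \in orbit to' G' (f y))} ->
  #|orbit to G @: S| = #|orbit to' G' @: (f @: S)|.
Proof.
move=> f_orb; rewrite -imset_comp; apply: card_imset_eq_kernel => x y Sx Sy /=.
apply/eqP/eqP => /orbit_eqP; first by rewrite f_orb // => /orbit_eqP.
by rewrite -f_orb // => /orbit_eqP.
Qed.

(** * Bars and involutions in a connection set *)

Section Bars.

Variable gT : finGroupType.
Implicit Types (x y : gT) (O : {set gT}) (a : {perm gT}).

Lemma sqg_eq1 x : (x ^+ 2 == 1) = (x^-1 == x).
Proof. by rewrite expgS expg1 -eq_invg_mul. Qed.

Lemma bar_id x : x \in bar x. Proof. exact: set21. Qed.

Lemma barV x : bar x^-1 = bar x. Proof. by rewrite /bar invgK setUC. Qed.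

Lemma mem_bar x y : (y \in bar x) = (bar y == bar x).
Proof.
apply/idP/eqP => [/set2P[] -> // | <-]; [exact: barV | exact: bar_id].
Qed.

Lemma bar_repr x : bar (repr (bar x)) = bar x.
Proof. by apply/eqP; rewrite -mem_bar (mem_repr x) ?bar_id. Qed.

Lemma bar_sqg_eq1 x y : bar x = bar y -> (x ^+ 2 == 1) = (y ^+ 2 == 1).
Proof.
by move/eqP; rewrite -mem_bar => /set2P[] -> //; rewrite expgVn invg_eq1.
Qed.

(** The bar of an element with trivial square is a singleton. *)
Lemma bar_inj_sqg1 x y : y ^+ 2 = 1 -> bar x = bar y -> x = y.
Proof.
move/eqP; rewrite sqg_eq1 => /eqP yV /eqP; rewrite -mem_bar.
by case/set2P=> ->.
Qed.

Lemma card_bar x : x ^+ 2 != 1 -> #|bar x| = 2.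
Proof. by rewrite sqg_eq1 eq_sym => xV; rewrite cards2 xV. Qed.

Definition bars_x O := @bar gT @: [set x in O | x ^+ 2 != 1].
Definition bars_y O := @bar gT @: O2 O.

Lemma card_bars_y O : #|bars_y O| = #|O2 O|.
Proof.
apply: card_in_imset => x y _; rewrite inE => /and3P[_ /eqP y2 _].
exact: bar_inj_sqg1.
Qed.

(** The elements with nontrivial square fall into fibres of [bar]; closure under inverses makes each
    fibre a full pair. As 1 is excluded, what remains is [O2 O]. *)
Lemma card_bars O : O^-1 = O -> 1 \notin O ->
  #|O| = (2 * #|bars_x O| + #|O2 O|)%N.
Proof.
move=> OV O1; rewrite -(cardsID [set x | x ^+ 2 != 1] O); congr (_ + _)%N.
  rewrite -setIdE -sum1_card (partition_big_imset (@bar gT)) /= -/(bars_x O).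
  rewrite mulnC -sum_nat_const; apply: eq_bigr => B /imsetP[x].
  rewrite inE => /andP[Ox x2] -> {B}; rewrite sum1dep_card -[RHS](card_bar x2).
  apply: eq_card => y; rewrite !inE -[RHS]in_set2 -/(bar x) mem_bar andbC.
  case: eqP => //= exy; rewrite (bar_sqg_eq1 exy) x2 andbT.
  move/eqP: exy; rewrite -mem_bar => /set2P[] -> //.
  by rewrite -OV inE invgK.
apply: eq_card => x; rewrite !inE negbK andbC; case Ox: (x \in O) => //=.
by have [x1|] := eqVneq x 1; rewrite ?andbT //; rewrite x1 (negPf O1) in Ox.
Qed.

Lemma memV_set O x : O^-1 = O -> (x^-1 \in O) = (x \in O).
Proof. by move=> OV; rewrite -{1}OV inE invgK. Qed.

Lemma eq_bar_mem O x y : O^-1 = O -> bar x = bar y -> (x \in O) = (y \in O).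
Proof.
by move=> OV /eqP; rewrite -mem_bar => /set2P[] -> //; rewrite memV_set.
Qed.

(* The union of the terms of t, provided they are bars. *)
Definition bars_union m k (t : bar_tuple gT m k) : {set gT} :=
  [set x | (bar x \in t.1) || (bar x \in t.2)].

(** Membership in [O] depends only on the bar, and the square of an element decides which block
    holds its bar. *)
Lemma bars_unionE m k (t : bar_tuple gT m k) O :
    O^-1 = O -> 1 \notin O -> t.1 =i bars_x O -> t.2 =i bars_y O ->
  bars_union t = O.
Proof.
move=> OV O1 t1 t2; apply/setP=> x; rewrite inE t1 t2.
apply/orP/idP => [[] /imsetP[y]|Ox].
- by rewrite inE => /andP[Oy _] /(eq_bar_mem OV)->.
- by rewrite inE => /andP[Oy _] /(eq_bar_mem OV)->.
have [x2|x2] := boolP (x ^+ 2 == 1); [right|left]; apply: imset_f.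
  by rewrite inE Ox x2 /=; apply: contraNneq O1 => <-.
by rewrite inE Ox.
Qed.

(** * Tuples of bars as enumerations attached to a connection set *)

Lemma GmkP m k O :
  reflect [/\ O^-1 = O, <<O>> = [set: gT], #|O| = m, 1 \notin O
            & #|O2 O| = (m - 2 * k)%N]
          (O \in Gmk gT m k).
Proof.
rewrite !inE; apply: (iffP andP) => [[/and4P[/eqP-> /eqP-> /eqP-> ->] /eqP->] //|].
by case=> -> -> -> -> ->; rewrite !eqxx.
Qed.

(** Removes the choice of representatives: only the set [O] and an ordering of its two kinds of bars
    remain. The bound makes [m - 2 * k] exact, which gives [#|O| = m]. *)
Lemma barGP m k (t : bar_tuple gT m k) : 2 * k <= m ->
  reflect (exists2 O, O \in Gmk gT m k &
             [/\ uniq t.1, uniq t.2, t.1 =i bars_x O & t.2 =i bars_y O])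
          (t \in barG gT m k).
Proof.
move=> le_km; apply: (iffP imsetP) => [[z] | [O /GmkP[OV Ogen Om O1 Ok]]].
  rewrite !inE => /and4P[]; rewrite cat_uniq => /and3P[U1 _ U2].
  move=> /allP z1P /allP z2P /eqP zgen tE.
  have T1: val t.1 = map (@bar gT) z.1 by rewrite tE.
  have T2: val t.2 = map (@bar gT) z.2 by rewrite tE.
  set O := bars_union t.
  have z2sq y : y \in z.2 -> y ^+ 2 == 1.
    by case/z2P/andP=> yV _; rewrite sqg_eq1.
  have OV : O^-1 = O by apply/setP=> x; rewrite !inE barV.
  have O1 : 1 \notin O.
    rewrite inE; apply/norP; split; apply/negP; rewrite memtE ?T1 ?T2.
      case/mapP=> x /z1P /[swap] /bar_sqg_eq1 <-.
      by rewrite expg1n eqxx.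
    case/mapP=> y zy /esym/bar_inj_sqg1 y1; case/andP: (z2P y zy) => _ /eqP[].
    by apply: y1; rewrite expg1n.
  have t1 : t.1 =i bars_x O.
    move=> B; apply/idP/imsetP=> [|[x]].
      rewrite memtE T1 => /mapP[x zx ->]; exists x => //.
      by rewrite !inE memtE T1 map_f // z1P.
    rewrite !inE => /andP[xt x2] ->; case/orP: xt => //.
    rewrite memtE T2 => /mapP[y zy /bar_sqg_eq1 exy].
    by rewrite exy z2sq in x2.
  have t2 : t.2 =i bars_y O.
    move=> B; apply/idP/imsetP=> [|[x]].
      rewrite memtE T2 => /mapP[y zy ->]; exists y => //.
      rewrite !inE (memtE t.2) T2 map_f // orbT z2sq //=.
      by case/andP: (z2P y zy).
    rewrite !inE => /and3P[xt x2 _] ->; case/orP: xt => //.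
    rewrite memtE T1 => /mapP[y zy /bar_sqg_eq1 exy].
    by rewrite exy (negPf (z1P y zy)) in x2.
  have uT1 : uniq t.1 by rewrite T1.
  have uT2 : uniq t.2 by rewrite T2.
  have cO2 : #|O2 O| = (m - 2 * k)%N.
    rewrite -card_bars_y -(eq_card t2); apply/eqP.
    by rewrite -[X in _ == X](size_tuple t.2); apply/eqP/card_uniqP.
  have cx : #|bars_x O| = k.
    rewrite -(eq_card t1); apply/eqP.
    by rewrite -[X in _ == X](size_tuple t.1); apply/eqP/card_uniqP.
  exists O => //; apply/GmkP; split=> //; last first.
    by rewrite card_bars // cO2 cx subnKC.
  apply/eqP; rewrite eqEsubset subsetT -zgen genS //.
  apply/subsetP=> x; rewrite !inE mem_cat !memtE T1 T2 => /orP[] zx.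
    by rewrite map_f.
  by rewrite (map_f _ zx) orbT.
case=> U1 U2 t1 t2.
(* The representatives required by [barG] are taken to be the [repr] of each bar. *)
have T1 : map (@bar gT) (map repr t.1) = t.1.
  rewrite -map_comp -[RHS]map_id; apply/eq_in_map => B.
  by rewrite -memtE t1 => /imsetP[x _ ->] /=; rewrite bar_repr.
have T2 : map (@bar gT) (map repr t.2) = t.2.
  rewrite -map_comp -[RHS]map_id; apply/eq_in_map => B.
  by rewrite -memtE t2 => /imsetP[x _ ->] /=; rewrite bar_repr.
exists (map_tuple repr t.1, map_tuple repr t.2); last first.
  by case: t T1 T2 {U1 U2 t1 t2} => t1 t2 T1 T2; congr (_, _); apply: val_inj.
have r1 B : B \in t.1 -> exists x, [/\ x \in O, x ^+ 2 != 1 & B = bar x].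
  by rewrite t1 => /imsetP[x]; rewrite inE => /andP[? ?] ->; exists x.
have r2 B : B \in t.2 -> exists x, [/\ x \in O, x ^+ 2 == 1, x != 1 & B = bar x].
  by rewrite t2 => /imsetP[x]; rewrite inE => /and3P[? ? ?] ->; exists x.
rewrite inE /= T1 T2 cat_uniq U1 U2 andbT /=; apply/and4P; split.
(* The blocks are disjoint: a bar determines whether the squares of its elements are trivial. *)
- apply/hasPn=> B /r2[x [_ x2 _ ->]]; apply/negP=> /r1[y [_ y2]].
  by move/bar_sqg_eq1; rewrite x2 (negPf y2).
- apply/allP=> _ /mapP[B /r1[x [_ x2 ->]] ->].
  by rewrite (bar_sqg_eq1 (bar_repr x)).
- apply/allP=> _ /mapP[B /r2[x [_ x2 x1 ->]] ->].
  rewrite (@bar_inj_sqg1 (repr (bar x)) x) ?bar_repr //; last exact/eqP.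
  by rewrite -sqg_eq1 x2.
rewrite eqEsubset subsetT -Ogen gen_subG; apply/subsetP=> x Ox.
(* The chosen representative may be [x^-1] instead of [x], so [x] is only sought in the generated
   subgroup. *)
set Z := [set _ in _]; suff rZ : repr (bar x) \in <<Z>>.
  have: x \in bar (repr (bar x)) by rewrite bar_repr bar_id.
  by case/set2P=> ->; rewrite ?groupV.
apply: mem_gen; rewrite inE mem_cat.
move: Ox; rewrite -(bars_unionE OV O1 t1 t2) inE => /orP[] tx.
  by rewrite (map_f _ tx).
by rewrite (map_f _ tx) orbT.
Qed.


(** * Automorphisms acting on connection sets and their bars *)

Lemma Aut_setTM a x y : a \in Aut [set: gT] -> a (x * y) = a x * a y.
Proof. by move=> Aa; rewrite -!(autmE Aa) morphM ?inE. Qed.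

Lemma Aut_setTV a x : a \in Aut [set: gT] -> a x^-1 = (a x)^-1.
Proof. by move=> Aa; rewrite -!(autmE Aa) morphV ?inE. Qed.

Lemma Aut_setT1 a : a \in Aut [set: gT] -> a 1 = 1.
Proof. by move=> Aa; rewrite -(autmE Aa) morph1. Qed.

Lemma Aut_sqg_eq1 a x : a \in Aut [set: gT] ->
  (a x ^+ 2 == 1) = (x ^+ 2 == 1).
Proof.
by move=> Aa; rewrite !sqg_eq1 -Aut_setTV // (inj_eq (@perm_inj _ a)).
Qed.

Lemma imset_sep_perm (P Q : pred gT) O a :
    (forall x, Q (a x) = P x) ->
  a @: [set x in O | P x] = [set x in a @: O | Q x].
Proof.
move=> QP; apply/setP=> y; rewrite inE; apply/imsetP/andP=> [[x]|[]].
  by rewrite inE => /andP[Ox Px] ->; rewrite imset_f // QP.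
by case/imsetP=> x Ox ->; rewrite QP => Px; exists x; rewrite ?inE ?Ox.
Qed.

Lemma O2_Aut a O : a \in Aut [set: gT] -> O2 (a @: O) = a @: O2 O.
Proof.
move=> Aa; apply/esym/imset_sep_perm => x.
by rewrite Aut_sqg_eq1 // -{2}(Aut_setT1 Aa) (inj_eq (@perm_inj _ a)).
Qed.

Lemma bars_Aut a O : a \in Aut [set: gT] ->
  @bar gT @: (a @: O) = (fun B : {set gT} => a @: B) @: (@bar gT @: O).
Proof.
by move=> Aa; rewrite -!imset_comp; apply: eq_imset => x /=; rewrite imset_bar.
Qed.

Lemma bars_x_Aut a O : a \in Aut [set: gT] ->
  bars_x (a @: O) = (fun B : {set gT} => a @: B) @: bars_x O.
Proof.
move=> Aa; rewrite -bars_Aut // (imset_sep_perm (Q := fun x => x ^+ 2 != 1)) //.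
by move=> x; rewrite Aut_sqg_eq1.
Qed.

Lemma bars_y_Aut a O : a \in Aut [set: gT] ->
  bars_y (a @: O) = (fun B : {set gT} => a @: B) @: bars_y O.
Proof. by move=> Aa; rewrite -bars_Aut // -O2_Aut. Qed.

Lemma Gm_Aut a m O : a \in Aut [set: gT] -> O \in Gm gT m -> a @: O \in Gm gT m.
Proof.
move=> Aa; rewrite !inE => /and4P[/eqP OV /eqP Ogen /eqP Om O1].
rewrite card_imset ?Om ?eqxx /=; last exact: perm_inj.
have -> : 1 \notin a @: O by rewrite -(Aut_setT1 Aa) mem_imset //; apply: perm_inj.
rewrite andbT; apply/andP; split.
  apply/eqP/setP=> y; rewrite inE -[y](permKV a) -Aut_setTV //.
  by rewrite !mem_imset ?memV_set //; apply: perm_inj.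
have -> : a @: O = autm Aa @* O by rewrite morphimEsub ?subsetT // autmE.
by rewrite -morphim_gen ?subsetT // Ogen im_autm.
Qed.

Lemma Gmk_Aut a m k O : a \in Aut [set: gT] ->
  O \in Gmk gT m k -> a @: O \in Gmk gT m k.
Proof.
move=> Aa; rewrite ![_ \in Gmk _ _ _]inE => /andP[GO /eqP O2k].
by rewrite Gm_Aut // O2_Aut // card_imset ?O2k ?eqxx //; apply: perm_inj.
Qed.

(** * The action on tuples of bars and its orbits *)

Section BarAction.

Variables m k : nat.

(* bar_act with AutK recast as a group type and the arguments in the order of an
   action; permutations compose left to right, so this is a right action. *)
Definition bar_op (t : bar_tuple gT m k)
  (p : ({perm gT} * ('S_k * 'S_(m - 2 * k)))%type) := bar_act p t.

Lemma bar_op1 : bar_op^~ 1 =1 id.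
Proof.
case=> t1 t2; rewrite /bar_op /=; congr (_, _); apply: eq_from_tnth => i;
  by rewrite tnth_mktuple invg1 perm1 (eq_imset _ (@perm1 _)) imset_id.
Qed.

Lemma bar_opM t : act_morph bar_op t.
Proof.
case=> [a [s r]] [b [s' r']]; rewrite /bar_op /=.
congr (_, _); apply: eq_from_tnth => i; rewrite !tnth_mktuple invMg permM.
  by rewrite -imset_comp; apply: eq_imset => x; rewrite permM.
by rewrite -imset_comp; apply: eq_imset => x; rewrite permM.
Qed.

Canonical bar_action := TotalAction bar_op1 bar_opM.

Lemma perm_eq_mktuple_imset n (T : n.-tuple {set gT}) a (s : 'S_n) :
  perm_eq [tuple a @: tnth T (s^-1 i) | i < n]
          (map (fun B : {set gT} => a @: B) T).
Proof.
apply/(@tuple_permP _ _ _ (map_tuple (fun B : {set gT} => a @: B) T)).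
exists s^-1; congr val; apply: eq_from_tnth => i.
by rewrite !tnth_mktuple tnth_map.
Qed.

Lemma imset_perm_inj a : injective (fun B : {set gT} => a @: B).
Proof. exact/imset_inj/perm_inj. Qed.

Lemma mem_map_imset a (s : seq {set gT}) (P : {set {set gT}}) :
  s =i P -> map (fun B : {set gT} => a @: B) s =i (fun B : {set gT} => a @: B) @: P.
Proof.
move=> sP C.
by apply/mapP/imsetP => -[B]; rewrite ?sP => PB ->; exists B; rewrite ?sP.
Qed.

Hypothesis le_km : 2 * k <= m.

Lemma bars_union_Gmk t : t \in barG gT m k -> bars_union t \in Gmk gT m k.
Proof.
case/(barGP _ le_km)=> O GO [_ _ t1 t2]; have /GmkP[OV _ _ O1 _] := GO.
by rewrite (bars_unionE OV O1 t1 t2).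
Qed.

Lemma barG_bars t : t \in barG gT m k ->
  [/\ uniq t.1, uniq t.2, t.1 =i bars_x (bars_union t)
    & t.2 =i bars_y (bars_union t)].
Proof.
case/(barGP _ le_km)=> O /GmkP[OV _ _ O1 _] [u1 u2 t1 t2].
by rewrite (bars_unionE OV O1 t1 t2).
Qed.

Lemma bars_union_barG : @bars_union m k @: barG gT m k = Gmk gT m k.
Proof.
apply/setP=> O; apply/imsetP/idP => [[t Gt ->]|GO]; first exact: bars_union_Gmk.
have /GmkP[OV _ Om O1 Ok] := GO.
(* [card_bars] reads [m = 2 * #|bars_x O| + (m - 2 * k)], and [le_km] makes the subtraction
   exact. *)
have cx : size (enum (bars_x O)) == k.
  by rewrite -cardE; apply/eqP; move: (card_bars OV O1) le_km; lia.
have cy : size (enum (bars_y O)) == (m - 2 * k)%N by rewrite -cardE card_bars_y Ok.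
pose t : bar_tuple gT m k := (Tuple cx, Tuple cy).
have t1 : t.1 =i bars_x O by move=> B; rewrite memtE /= mem_enum.
have t2 : t.2 =i bars_y O by move=> B; rewrite memtE /= mem_enum.
exists t; last by rewrite (bars_unionE OV O1 t1 t2).
by apply/(barGP _ le_km); exists O => //; split=> //; apply: enum_uniq.
Qed.

(** Up to order, the new terms are the images of the old ones, hence the bars of the image set; the
    two permutations do not affect the union. *)
Lemma bar_op_barG t p : p.1 \in Aut [set: gT] -> t \in barG gT m k ->
  bar_op t p \in barG gT m k /\ bars_union (bar_op t p) = p.1 @: bars_union t.
Proof.
case: p => a [s r] /= Aa Gt; have [u1 u2 t1 t2] := barG_bars Gt.
have GO := Gmk_Aut Aa (bars_union_Gmk Gt).
have pe1 := perm_eq_mktuple_imset t.1 a s.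
have pe2 := perm_eq_mktuple_imset t.2 a r.
have T1 : (bar_op t (a, (s, r))).1 =i bars_x (a @: bars_union t).
  by move=> B; rewrite bars_x_Aut // -(mem_map_imset _ t1) -(perm_mem pe1).
have T2 : (bar_op t (a, (s, r))).2 =i bars_y (a @: bars_union t).
  by move=> B; rewrite bars_y_Aut // -(mem_map_imset _ t2) -(perm_mem pe2).
have /GmkP[OV _ _ O1 _] := GO.
split; last exact: bars_unionE.
apply/(barGP _ le_km); exists (a @: bars_union t) => //; split=> //=.
  by rewrite (perm_uniq pe1) map_inj_uniq //; apply: imset_perm_inj.
by rewrite (perm_uniq pe2) map_inj_uniq //; apply: imset_perm_inj.
Qed.

(** Supplies the permutations showing that tuples with the same terms lie in one orbit; the inverse
    of the rearranging permutation is taken because the action reads positions through [s^-1]. *)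
Lemma imset_mktuple_of_perm_eq n (T T' : n.-tuple {set gT}) a :
    perm_eq T' (map (fun B : {set gT} => a @: B) T) ->
  exists s : 'S_n, [tuple a @: tnth T (s^-1 i) | i < n] = T'.
Proof.
case/(@tuple_permP _ _ _ (map_tuple (fun B : {set gT} => a @: B) T)) => s T's.
exists s^-1; apply: val_inj; rewrite [RHS]T's; congr (tval _).
by apply: eq_from_tnth => i; rewrite !tnth_mktuple invgK tnth_map.
Qed.

Variable H : {group {perm gT}}.
Hypothesis sHA : H \subset Aut [set: gT].

Lemma orbit_barG : {in barG gT m k &, forall t t',
  (t \in orbit bar_action (setX H [set: 'S_k * 'S_(m - 2 * k)]) t')
    = (bars_union t \in orbit 'P^* H (bars_union t'))}.
Proof.
move=> t' t Gt' Gt; apply/orbitP/orbitP => [[[a sr]]|[a Ha /=]].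
  rewrite !inE /= andbT => Ha <-; exists a => //.
  by have [_ ->] := @bar_op_barG t (a, sr) (subsetP sHA a Ha) Gt; rewrite setactE.
rewrite setactE => Ea; have Aa := subsetP sHA a Ha.
have [u1 u2 t1 t2] := barG_bars Gt; have [u1' u2' t1' t2'] := barG_bars Gt'.
have {}Ea : bars_union t' = a @: bars_union t by rewrite -Ea; apply: eq_imset.
have [s Es] : exists s : 'S_k, [tuple a @: tnth t.1 (s^-1 i) | i < k] = t'.1.
  apply: imset_mktuple_of_perm_eq; apply: uniq_perm => // [|B].
    by rewrite map_inj_uniq //; apply: imset_perm_inj.
  by rewrite (mem_map_imset _ t1) -bars_x_Aut // -Ea -t1'.
have [r Er] : exists r : 'S_(m - 2 * k),
    [tuple a @: tnth t.2 (r^-1 i) | i < (m - 2 * k)%N] = t'.2.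
  apply: imset_mktuple_of_perm_eq; apply: uniq_perm => // [|B].
    by rewrite map_inj_uniq //; apply: imset_perm_inj.
  by rewrite (mem_map_imset _ t2) -bars_y_Aut // -Ea -t2'.
exists (a, (s, r)); first by rewrite !inE Ha.
by rewrite /bar_op /= Es Er; case: (t').
Qed.

Lemma sum_Fix_barG :
  (\sum_(p in HK m k H) #|Fix_barG p| =
   #|Gmk_orbits m k H| * (#|H| * k`! * (m - 2 * k)`!))%N.
Proof.
pose K := (setX H [set: 'S_k * 'S_(m - 2 * k)])%G.
have actsK : [acts K, on barG gT m k | bar_action].
  apply/subsetP=> p; rewrite !inE /= andbT => Hp.
  apply/subsetP=> t Gt; rewrite inE /=.
  by have [] := bar_op_barG (subsetP sHA _ Hp) Gt.
have -> : #|Gmk_orbits m k H| = #|orbit bar_action K @: barG gT m k|.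
  by rewrite (card_orbits_equivariant orbit_barG) bars_union_barG.
rewrite -mulnA -!card_Sn -card_prod -cardsT -cardsX -(Frobenius_Cauchy actsK).
apply: eq_bigr => p _; apply: eq_card => t; rewrite !inE.
by rewrite sub1set inE.
Qed.

End BarAction.

(** * Orbits on [Gm] and their splitting over [k] *)

Variable H : {group {perm gT}}.
Hypothesis sHA : H \subset Aut [set: gT].

Lemma orbit_imsetP O O' :
  reflect (exists2 a, a \in H & O' = a @: O) (O' \in orbit 'P^* H O).
Proof.
apply: (iffP orbitP) => -[a Ha]; last by move->; exists a.
by move=> <-; exists a.
Qed.

(** The classes are taken inside [Gm], but automorphisms preserve [Gm], so each class is a whole
    orbit. *)
Lemma equivalence_partition_orbits m (R : rel {set gT}) :
    (forall O O', R O O' = (O' \in orbit 'P^* H O)) ->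
  equivalence_partition R (Gm gT m) = orbit 'P^* H @: Gm gT m.
Proof.
move=> RE; apply: eq_in_imset => O GO; apply/setP=> O'.
rewrite inE RE andb_idl // => /orbit_imsetP[a Ha ->].
by rewrite Gm_Aut // (subsetP sHA).
Qed.

(** The index of [O] is [#|bars_x O|], at most [m %/ 2] by [card_bars]. *)
Lemma Gm_bigcup m : Gm gT m = \bigcup_(k < (m %/ 2).+1) Gmk gT m k.
Proof.
apply/setP=> O; apply/idP/bigcupP => [GO|[k _]]; last by rewrite inE => /andP[].
have: O \in Gm gT m by [].
rewrite inE => /and4P[/eqP OV _ /eqP Om O1].
have cO := card_bars OV O1; rewrite Om in cO.
have lek : #|bars_x O| < (m %/ 2).+1.
  by rewrite ltnS leq_divRL // mulnC cO leq_addr.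
by exists (Ordinal lek) => //; rewrite inE GO /= cO addKn.
Qed.

(** Each piece is stable under [H], so no orbit meets two pieces and the counts add up. *)
Lemma card_orbits_Gm m :
  #|orbit 'P^* H @: Gm gT m|
    = (\sum_(0 <= k < (m %/ 2).+1) #|Gmk_orbits m k H|)%N.
Proof.
have -> : orbit 'P^* H @: Gm gT m = \bigcup_(k < (m %/ 2).+1) Gmk_orbits m k H.
  rewrite Gm_bigcup; apply/setP=> X; apply/imsetP/bigcupP.
    by case=> O /bigcupP[k _ Ok] ->; exists k => //; apply: imset_f.
  by case=> k _ /imsetP[O Ok ->]; exists O => //; apply/bigcupP; exists k.
rewrite -sum1_card partition_disjoint_bigcup.
  by rewrite big_mkord; apply: eq_bigr => k _; rewrite sum1_card.
move=> i j; apply: contraNT => /pred0Pn[X /andP[]] /=.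
case/imsetP=> O /[swap] -> Oi /imsetP[O' Oj /orbit_eqP/orbit_imsetP[a Ha EO]].
have:= Gmk_Aut (subsetP sHA a Ha) Oj; rewrite -EO => /GmkP[_ _ _ _ cj].
case/GmkP: Oi => _ _ _ _; rewrite cj => Eij; apply/eqP/val_inj => /=.
(* Both indices are at most [m %/ 2], so the truncated subtractions are exact and
   [m - 2 * i = m - 2 * j] forces [i = j]. *)
by move: (ltn_ord i) (ltn_ord j) Eij => /=; lia.
Qed.

End Bars.

(** * Equivalences of Cayley graphs as orbits of connection sets *)

Section Equivalences.

Variable gT : finGroupType.
Implicit Types (O : {set gT}) (a f : {perm gT}).

Canonical Inn_group := Eval hnf in [group of Inn gT].

Lemma Inn_sub_Aut : Inn gT \subset Aut [set: gT].
Proof. exact: Aut_conj_aut. Qed.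

(** Here [(f u)^-1 * f v = a (u^-1 * v) ^ c], so adjacency is transported by [x |-> a x ^ c]; edges
    at 1 already determine [O']. *)
Lemma cayley_iso_imset f a c O O' :
    a \in Aut [set: gT] -> (forall u, f u = a u * c) ->
  (forall u v, cayley O u v = cayley O' (f u) (f v)) <->
  O' = [set a x ^ c | x in O].
Proof.
move=> Aa fE.
have O'E u v : cayley O' (f u) (f v) = (a (u^-1 * v) ^ c \in O').
  by rewrite /cayley !fE Aut_setTM // Aut_setTV // conjgE invMg !mulgA.
have aJ_inj : injective (fun x => a x ^ c).
  by move=> x y /conjg_inj/perm_inj.
split=> [fi | O'i u v]; last by rewrite O'E O'i (mem_imset _ _ aJ_inj).
apply/setP=> y; apply/idP/imsetP => [O'y | [x Ox ->]].
  exists (a^-1 (y ^ c^-1)); last by rewrite permKV conjgKV.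
  have:= fi 1 (a^-1 (y ^ c^-1)).
  by rewrite O'E /cayley invg1 mul1g permKV conjgKV O'y.
by have:= fi 1 x; rewrite O'E /cayley invg1 mul1g Ox.
Qed.

Lemma conj_aut_setTE c x : conj_aut [set: gT] c x = x ^ c.
Proof. by rewrite norm_conj_autE ?inE //; apply/subsetP=> y; rewrite inE. Qed.

Lemma conj_aut_Inn c : conj_aut [set: gT] c \in Inn gT.
Proof. by apply/InnP; exists c => x; apply: conj_aut_setTE. Qed.

(** The translation part [f 1] of an isomorphism acts on [O] by conjugation and is absorbed into the
    automorphism; conversely an automorphism is its own isomorphism, with [c = 1]. *)
Lemma weak_equivE O O' :
  weak_equiv O O' = (O' \in orbit 'P^* (Aut [set: gT]) O).
Proof.
apply/weak_equivP/(orbit_imsetP (Aut_group [set: gT])).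
  case=> f [a Aa [fi fa]].
  have fE u : f u = a u * f 1 by rewrite -fa mulg1.
  exists (a * conj_aut [set: gT] (f 1)).
    by rewrite groupM // (subsetP Inn_sub_Aut) ?conj_aut_Inn.
  rewrite ((cayley_iso_imset O O' Aa fE).1 fi).
  by apply: eq_imset => x; rewrite permM conj_aut_setTE.
case=> a Aa ->; exists a, a => //; split=> [|g u]; last exact: Aut_setTM.
apply/(cayley_iso_imset (c := 1) _ _ Aa) => [u|]; first by rewrite mulg1.
by apply: eq_imset => x; rewrite conjg1.
Qed.

(** With trivial automorphism part only conjugation by [f 1] is left, and conjugation by [c] comes
    from the right translation [u |-> u * c]. *)
Lemma equivE O O' : Defs.equiv O O' = (O' \in orbit 'P^* (Inn gT) O).
Proof.
have fE1 f c : (forall u, f u = u * c) -> forall u, f u = (1 : {perm gT}) u * c.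
  by move=> fE u; rewrite perm1.
apply/Defs.equivP/(orbit_imsetP Inn_group).
  case=> f [fi fa].
  have fE u : f u = u * f 1 by rewrite -fa mulg1.
  exists (conj_aut [set: gT] (f 1)); first exact: conj_aut_Inn.
  rewrite ((cayley_iso_imset O O' (group1 _) (fE1 f _ fE)).1 fi).
  by apply: eq_imset => x; rewrite perm1 conj_aut_setTE.
case=> a /InnP[c aE] ->; exists (perm (mulIg c)).
split=> [|g u]; last by rewrite !permE mulgA.
apply/(cayley_iso_imset (c := c) _ _ (group1 _)) => [u|]; first by rewrite permE perm1.
by apply: eq_imset => x; rewrite perm1 aE.
Qed.

End Equivalences.

(** * The counting formulas over the rationals *)

Import GRing.Theory Num.Theory.
Local Open Scope ring_scope.

Lemma card_Gmk_orbits_ratio (gT : finGroupType) (m k : nat)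
    (H : {group {perm gT}}) :
    H \subset Aut [set: gT] -> (2 * k <= m)%N ->
  #|Gmk_orbits m k H|%:R =
    (\sum_(p in HK m k H) #|Fix_barG p|%:R)
      / (#|H| * k`! * (m - 2 * k)`!)%:R :> rat.
Proof.
move=> sHA le_km; rewrite -natr_sum sum_Fix_barG // natrM mulfK //.
by rewrite pnatr_eq0 -lt0n !muln_gt0 cardG_gt0 !fact_gt0.
Qed.

(** Kept general in [H] so that [Aut] and [Inn] give the weak and the strict count alike. *)
Lemma num_classes_formulas (gT : finGroupType) (m : nat)
    (H : {group {perm gT}}) (R : rel {set gT}) :
    H \subset Aut [set: gT] ->
    (forall O O', R O O' = (O' \in orbit 'P^* H O)) ->
  #|equivalence_partition R (Gm gT m)|
    = (\sum_(0 <= k < (m %/ 2).+1) #|Gmk_orbits m k H|)%N /\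
  #|equivalence_partition R (Gm gT m)|%:R = \sum_(0 <= k < (m %/ 2).+1)
    (\sum_(p in HK m k H) #|Fix_barG p|%:R)
      / (#|H| * k`! * (m - 2 * k)`!)%:R :> rat.
Proof.
move=> sHA RE; rewrite (equivalence_partition_orbits sHA _ RE).
rewrite card_orbits_Gm //; split=> //; rewrite natr_sum.
apply: eq_big_nat => k /andP[_ lt_k]; apply: card_Gmk_orbits_ratio => //; lia.
Qed.

Theorem theorem3p1 (gT : finGroupType) (m : nat) (hm : (0 < m)%N) :
  [/\ num_weak_equiv gT m = (\sum_(0 <= k < (m %/ 2).+1) #|Gmk_orbits m k (Aut [set: gT])|)%N,
      (num_weak_equiv gT m)%:R = \sum_(0 <= k < (m %/ 2).+1)
        (\sum_(p in HK m k (Aut [set: gT])) #|Fix_barG p|%:R)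
          / (#|Aut [set: gT]| * k`! * (m - 2 * k)`!)%:R :> rat,
      num_equiv gT m = (\sum_(0 <= k < (m %/ 2).+1) #|Gmk_orbits m k (Inn gT)|)%N
    & (num_equiv gT m)%:R = \sum_(0 <= k < (m %/ 2).+1)
        (\sum_(p in HK m k (Inn gT)) #|Fix_barG p|%:R)
          / (#|Inn gT| * k`! * (m - 2 * k)`!)%:R :> rat].
Proof.
have [w1 w2] := num_classes_formulas m (subxx (Aut [set: gT]))
  (@weak_equivE gT : forall O O', _ = (O' \in orbit 'P^* (Aut_group [set: gT]) O)).
have [e1 e2] := num_classes_formulas m (Inn_sub_Aut gT : Inn_group gT \subset _) (@equivE gT).
by split.
Qed.
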